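(* Let $\mathbb H$ be the division ring of real quaternions. Then the multiplicative group $\mathbb H^*=\mathbb H\setminus\{0\}$ contains no abelian maximal subgroup.
   Context: A maximal subgroup of a group $G$ is a proper subgroup not properly contained in any proper subgroup of $G$. *)

(* Defs.v *)
From HB Require Import structures.
From mathcomp Require Import all_boot all_order all_algebra.
From mathcomp Require Import ring lra.
From mathcomp Require Import boolp classical_sets reals.

Set Implicit Arguments.
Unset Strict Implicit.
Unset Printing Implicit Defensive.

Import Order.TTheory GRing.Theory Num.Theory.

(* [Quat a b c d] is a + b i + c j + d k. *)
Record quaternion (R : realType) :=
  Quat { qre : R; qi : R; qj : R; qk : R }.

Section QuaternionRing.
Local Open Scope ring_scope.
Variable R : realType.
Local Notation H := (quaternion R).
Implicit Types x y z : H.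

Definition quat_to_tuple x : R * R * R * R := (qre x, qi x, qj x, qk x).
Definition quat_of_tuple (t : R * R * R * R) : H :=
  let: (a, b, c, d) := t in Quat a b c d.

Lemma quat_to_tupleK : cancel quat_to_tuple quat_of_tuple.
Proof. by case. Qed.

HB.instance Definition _ := Choice.copy H (can_type quat_to_tupleK).

Definition quat0 : H := Quat 0 0 0 0.
Definition quat1 : H := Quat 1 0 0 0.
Definition oppquat x : H := Quat (- qre x) (- qi x) (- qj x) (- qk x).
Definition addquat x y : H :=
  Quat (qre x + qre y) (qi x + qi y) (qj x + qj y) (qk x + qk y).

(* The bilinear extension of i^2 = j^2 = k^2 = ijk = -1. *)
Definition mulquat x y : H :=
  Quat (qre x * qre y - qi x * qi y - qj x * qj y - qk x * qk y)
       (qre x * qi y + qi x * qre y + qj x * qk y - qk x * qj y)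
       (qre x * qj y - qi x * qk y + qj x * qre y + qk x * qi y)
       (qre x * qk y + qi x * qj y - qj x * qi y + qk x * qre y).

Definition sqnormquat x : R := qre x ^+ 2 + qi x ^+ 2 + qj x ^+ 2 + qk x ^+ 2.

(* The conjugate divided by the squared norm; it maps 0 to 0. *)
Definition invquat x : H :=
  Quat (qre x / sqnormquat x) (- qi x / sqnormquat x)
       (- qj x / sqnormquat x) (- qk x / sqnormquat x).

Lemma addquatA : associative addquat.
Proof. by move=> x y z; rewrite /addquat /= !addrA. Qed.

Lemma addquatC : commutative addquat.
Proof. by move=> x y; congr Quat; rewrite addrC. Qed.

Lemma add0quat : left_id quat0 addquat.
Proof. by case=> a b c d; rewrite /addquat /= !add0r. Qed.

Lemma addNquat : left_inverse quat0 oppquat addquat.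
Proof. by move=> x; rewrite /addquat /= !addNr. Qed.

HB.instance Definition _ :=
  GRing.isZmodule.Build H addquatA addquatC add0quat addNquat.

Lemma mulquatA : associative mulquat.
Proof. by move=> x y z; rewrite /mulquat /=; congr Quat; ring. Qed.

Lemma mul1quat : left_id quat1 mulquat.
Proof. by case=> a b c d; rewrite /mulquat /=; congr Quat; ring. Qed.

Lemma mulquat1 : right_id quat1 mulquat.
Proof. by case=> a b c d; rewrite /mulquat /=; congr Quat; ring. Qed.

Lemma mulquatDl : left_distributive mulquat addquat.
Proof. by move=> x y z; congr Quat; rewrite /=; ring. Qed.

Lemma mulquatDr : right_distributive mulquat addquat.
Proof. by move=> x y z; congr Quat; rewrite /=; ring. Qed.

Lemma quat1_neq0 : quat1 != 0 :> H.
Proof. by apply/eqP => -[/eqP]; rewrite oner_eq0. Qed.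

HB.instance Definition _ := GRing.Zmodule_isNzRing.Build H
  mulquatA mul1quat mulquat1 mulquatDl mulquatDr quat1_neq0.

Lemma sqnormquat_neq0 x : x != 0 -> sqnormquat x != 0.
Proof.
apply: contraNneq; case: x => a b c d; rewrite /sqnormquat /= => n0.
have a2 := sqr_ge0 a; have b2 := sqr_ge0 b.
have c2 := sqr_ge0 c; have d2 := sqr_ge0 d.
have sq0 (t : R) : t ^+ 2 <= 0 -> t = 0.
  by move=> t0; apply/eqP; rewrite -sqrf_eq0 eq_le t0 sqr_ge0.
by apply/eqP; congr Quat; apply: sq0; lra.
Qed.

Lemma mulVquat : {in [pred x : H | x != 0], left_inverse 1 invquat *%R}.
Proof.
move=> x /sqnormquat_neq0; case: x => a b c d; rewrite /sqnormquat /= => n0.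
by congr Quat; rewrite /= /sqnormquat /=; field.
Qed.

Lemma mulquatV : {in [pred x : H | x != 0], right_inverse 1 invquat *%R}.
Proof.
move=> x /sqnormquat_neq0; case: x => a b c d; rewrite /sqnormquat /= => n0.
by congr Quat; rewrite /= /sqnormquat /=; field.
Qed.

Lemma quat_unitP x y : y * x = 1 /\ x * y = 1 -> x != 0.
Proof.
by case=> yx1 _; apply/eqP => x0; move/eqP: yx1; rewrite x0 mulr0 eq_sym oner_eq0.
Qed.

Lemma invquat_out : {in [predC [pred x : H | x != 0]], invquat =1 id}.
Proof.
by move=> x; rewrite !inE negbK => /eqP ->; congr Quat; rewrite /= ?oppr0 mul0r.
Qed.

HB.instance Definition _ := GRing.NzRing_hasMulInverse.Build H
  mulVquat mulquatV quat_unitP invquat_out.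

(* mathcomp has no structure for noncommutative division rings. *)
Lemma quat_unitE x : (x \is a GRing.unit) = (x != 0).
Proof. by []. Qed.

End QuaternionRing.

(* mathcomp puts no group structure on the units of an infinite ring. *)
Record nzquat (R : realType) :=
  NzQuat { nzquat_val : quaternion R; nzquat_neq0 : (nzquat_val != 0)%R }.

Section NonzeroQuaternionGroup.
Local Open Scope ring_scope.
Variable R : realType.
Local Notation Hx := (nzquat R).

HB.instance Definition _ := [isSub of Hx for @nzquat_val R].
HB.instance Definition _ := [Choice of Hx by <:].

Lemma nzquat_unit (x : Hx) : nzquat_val x \is a GRing.unit.
Proof. by rewrite quat_unitE nzquat_neq0. Qed.

Lemma nzquat_mul_subproof (x y : Hx) : nzquat_val x * nzquat_val y != 0.
Proof. by rewrite -quat_unitE unitrMl ?nzquat_unit. Qed.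

Lemma nzquat_inv_subproof (x : Hx) : (nzquat_val x)^-1 != 0.
Proof. by rewrite -quat_unitE unitrV nzquat_unit. Qed.

Definition nzquat_one : Hx := NzQuat (oner_neq0 (quaternion R)).
Definition nzquat_mul (x y : Hx) : Hx := NzQuat (nzquat_mul_subproof x y).
Definition nzquat_inv (x : Hx) : Hx := NzQuat (nzquat_inv_subproof x).

Lemma nzquat_mulA : associative nzquat_mul.
Proof. by move=> x y z; apply: val_inj; rewrite /= mulrA. Qed.

Lemma nzquat_mul1 : left_id nzquat_one nzquat_mul.
Proof. by move=> x; apply: val_inj; rewrite /= mul1r. Qed.

Lemma nzquat_mulr1 : right_id nzquat_one nzquat_mul.
Proof. by move=> x; apply: val_inj; rewrite /= mulr1. Qed.

Lemma nzquat_mulV : left_inverse nzquat_one nzquat_inv nzquat_mul.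
Proof. by move=> x; apply: val_inj; rewrite /= mulVr ?nzquat_unit. Qed.

Lemma nzquat_mulrV : right_inverse nzquat_one nzquat_inv nzquat_mul.
Proof. by move=> x; apply: val_inj; rewrite /= divrr ?nzquat_unit. Qed.

HB.instance Definition _ := isGroup.Build Hx
  nzquat_mulA nzquat_mul1 nzquat_mulr1 nzquat_mulV nzquat_mulrV.

End NonzeroQuaternionGroup.

Section Subgroups.
Local Open Scope classical_set_scope.
Variable G : groupType.
Implicit Types M K : set G.

Definition subgroup M : Prop := group_closed [in M].

Definition proper_subgroup M : Prop := subgroup M /\ M `<` [set: G].

Definition maximal_subgroup M : Prop :=
  proper_subgroup M /\ forall K, proper_subgroup K -> ~ M `<` K.

Definition abelian_subset M : Prop := {in M &, forall x y : G, commute x y}.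

End Subgroups.

(* Main.v *)
Require Import Defs.
From mathcomp Require Import all_boot all_order all_algebra.
From mathcomp Require Import boolp classical_sets reals.
From mathcomp Require Import ring lra.

Set Implicit Arguments.
Unset Strict Implicit.
Unset Printing Implicit Defensive.

Import GRing.Theory.

(** An abelian subgroup [M] commutes with some nonzero pure quaternion [v] (the
    vector part of a nonreal element of [M], or [i] if [M] is real). The
    stabilizer [K] of the line [R v] under conjugation, i.e. the set of [y] with
    [y v = v y] or [y v = - v y], is a subgroup containing [M]. A pure
    quaternion [y] orthogonal to [v] anticommutes with [v], so [y] is in [K] but
    not in [M], while [1 + y] is not in [K]; hence [M] is not maximal. *)

Section PureQuaternions.
Local Open Scope ring_scope.
Variable R : realType.
Implicit Types x v : quaternion R.

Definition vecpart x : quaternion R := Quat 0 (qi x) (qj x) (qk x).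

(** The real part of [x] is central, so [x] and [vecpart x] have the same additive commutator with
    [y]. *)
Lemma vecpart_comm x y : x * y = y * x -> vecpart x * y = y * vecpart x.
Proof.
case: x y => [a b c d] [p q r s] [_ hi hj hk].
by congr Quat; rewrite /=; lra.
Qed.

Lemma comm_vecpart0 x y : vecpart x = 0 -> x * y = y * x.
Proof.
case: x y => [a b c d] [p q r s] [-> -> ->].
by congr Quat; rewrite /=; ring.
Qed.

(** For pure [y] and [v], [y * v + v * y] is real, equal to -2 times their dot product; so a nonzero
    vector orthogonal to [v] suffices. *)
Lemma exists_anticomm v : qre v = 0 -> exists2 y, y != 0 & y * v = - (v * y).
Proof.
case: v => _ b c d /= ->.
have [/andP[/eqP -> /eqP ->]|bc] := boolP ((b == 0) && (c == 0)).
  exists (Quat 0 1 0 0); first by apply/eqP => -[/eqP]; rewrite oner_eq0.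
  by congr Quat; rewrite /=; ring.
(* Rotate the projection of [v] to the [i], [j] plane by a right angle. *)
exists (Quat 0 (- c) b 0); last by congr Quat; rewrite /=; ring.
apply: contraNneq bc => -[/eqP + ->]; rewrite oppr_eq0 => ->.
by rewrite eqxx.
Qed.

Lemma quat_neq_opp v : v != 0 -> v <> - v.
Proof.
case: v => a b c d /eqP v0 [ha hb hc hd]; apply: v0.
by congr Quat; lra.
Qed.

Lemma quat_mul_neq0 x y : x != 0 -> y != 0 -> x * y != 0.
Proof. by rewrite -!quat_unitE => ux uy; rewrite unitrMl. Qed.

End PureQuaternions.

Section LineStabilizer.
Local Open Scope ring_scope.
Local Open Scope classical_set_scope.
Variables (R : realType) (v : quaternion R).

Definition line_stabilizer : set (nzquat R) :=
  [set y | nzquat_val y * v = v * nzquat_val y \/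
           nzquat_val y * v = - (v * nzquat_val y)].

Lemma line_stabilizer_subgroup : subgroup line_stabilizer.
Proof.
split; first by apply/mem_set; left; rewrite mul1r mulr1.
move=> x y /set_mem xK /set_mem yK; apply/mem_set; rewrite /line_stabilizer /=.
have uy := nzquat_unit y.
(* Closure is tested on [x / y]; the sign attached to [y] is also that of its inverse, and signs
   multiply. *)
have {}yK : (nzquat_val y)^-1 * v = v * (nzquat_val y)^-1 \/
            (nzquat_val y)^-1 * v = - (v * (nzquat_val y)^-1).
  case: yK => yv; [left | right]; apply: (mulrI uy); apply: (mulIr uy).
    by rewrite mulVKr // mulrA -mulrA mulVr // mulr1 yv.
  by rewrite mulVKr // mulrN mulNr -!mulrA mulVr // mulr1 yv opprK.
rewrite -mulrA; case: yK xK => -> [xv|xv]; [left|right|right|left];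
  by rewrite ?mulrN !mulrA xv ?mulNr ?opprK.
Qed.

Lemma line_stabilizer_proper :
  v != 0 -> qre v = 0 -> proper_subgroup line_stabilizer.
Proof.
move=> v0 vre; split; first exact: line_stabilizer_subgroup.
have [y y0 yv] := exists_anticomm vre.
have vy0 := quat_mul_neq0 v0 y0.
(* Otherwise [y = -1] is central, and anticommuting gives [v = - v]. *)
have z0 : 1 + y != 0.
  apply/eqP => /eqP; rewrite addrC addr_eq0 => /eqP yE.
  by move: yv; rewrite yE mulN1r mulrN1 opprK => /esym/(quat_neq_opp v0).
rewrite properEneq; split=> //; apply/eqP => KT.
have : line_stabilizer (NzQuat z0) by rewrite KT.
(* Here [(1 + y) * v = v - v * y]; equality with [v + v * y] kills [v * y], equality with its
   opposite kills [v]. *)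
rewrite /line_stabilizer /= mulrDl mulrDr mul1r mulr1 yv => -[].
  by move=> /addrI/esym/(quat_neq_opp vy0).
by rewrite opprD => /addIr/(quat_neq_opp v0).
Qed.

End LineStabilizer.

Theorem corollary5p4 (R : realType) :
  ~ exists M : set (nzquat R), maximal_subgroup M /\ abelian_subset M.
Proof.
move=> [M [[[Msub _] Mmax] Mab]].
have [v [v0 vre Mv]] : exists v : quaternion R,
    [/\ v != 0%R, qre v = 0%R
     & forall y, M y -> (v * nzquat_val y = nzquat_val y * v)%R].
  have [[x Mx x0]|Mreal] :=
    pselect (exists2 x, M x & vecpart (nzquat_val x) != 0%R).
    exists (vecpart (nzquat_val x)); split=> // y My; apply: vecpart_comm.
    by have /(congr1 (@nzquat_val R)) := Mab x y (mem_set Mx) (mem_set My).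
  (* All of [M] is real, hence central: any nonzero pure quaternion would do. *)
  exists (Quat 0 1 0 0)%R; split=> //.
    by apply/eqP => -[/eqP]; rewrite oner_eq0.
  move=> y My; apply/esym/comm_vecpart0; apply/eqP; apply: contra_notT Mreal.
  by exists y.
have [y y0 yv] := exists_anticomm vre.
apply: (Mmax _ (line_stabilizer_proper v0 vre)); split.
  by move=> z Mz; left; rewrite Mv.
move=> /(_ (NzQuat y0)) KM.
have /Mv /= vy : M (NzQuat y0) by apply: KM; right.
by move: yv; rewrite -vy; exact/quat_neq_opp/quat_mul_neq0.
Qed.
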